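(* Let $G$ be a finite-by-nilpotent group. Then: (a) the non-abelian tensor square $G \otimes G$ is finite-by-nilpotent; (b) the group $\nu(G)$ is nilpotent-by-finite.
   Context: Conventions: $x^y = y^{-1}xy$ and $[x,y] = x^{-1}y^{-1}xy$. Let $G^{\varphi}$ be an isomorphic copy of $G$ via $\varphi : g \mapsto g^{\varphi}$. The group $\nu(G)$ is defined by the presentation $$\nu(G) = \left\langle G \cup G^{\varphi} \mid [g,h^{\varphi}]^k = [g^k,(h^k)^{\varphi}] = [g,h^{\varphi}]^{k^{\varphi}},\ \forall g,h,k \in G \right\rangle,$$ where the relations of $G$ and of $G^{\varphi}$ are also understood to hold (i.e. $\nu(G)$ is the quotient of the free product $G * G^{\varphi}$ by the displayed relations). The subgroup $\Upsilon(G) = [G,G^{\varphi}]$ of $\nu(G)$, generated by all $[g,h^{\varphi}]$ with $g,h\in G$, is canonically isomorphic to the non-abelian tensor square $G \otimes G$ of Brown and Loday via $g \otimes h \mapsto [g,h^{\varphi}]$, and $G \otimes G$ is identified with $\Upsilon(G)$. A group is finite-by-nilpotent if it has a finite normal subgroup with nilpotent quotient (equivalently, some term $\gamma_k$ of its lower central series is finite). A group is nilpotent-by-finite if it has a nilpotent normal subgroup of finite index. *)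

(* Defs.v *)
From HB Require Import structures.
From mathcomp Require Import all_boot.
From mathcomp Require Import boolp classical_sets functions cardinality.

Set Implicit Arguments.
Unset Strict Implicit.
Unset Printing Implicit Defensive.

Local Open Scope classical_set_scope.
Local Open Scope quotient_scope.
Local Open Scope group_scope.

Section Subgroups.
Variable G : groupType.
Implicit Types A B H N : set G.

Definition subgroup H : Prop := group_closed (mem H).

Definition normal N : Prop :=
  subgroup N /\ forall x y : G, N x -> N (x ^ y).

Lemma normal_subgroup N : normal N -> subgroup N.
Proof. by case. Qed.

Definition generated A : set G := smallest subgroup A.

Definition normal_closure A : set G := smallest normal A.

Lemma subgroupP H :
  subgroup H <-> H 1 /\ forall x y, H x -> H y -> H (x / y).
Proof.
split=> [[H1 HF]|[H1 HF]]; split; rewrite ?inE //.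
- by move: H1; rewrite inE.
- move=> x y Hx Hy; have := HF x y; rewrite !inE; exact.
- by move=> x y; rewrite !inE; apply: HF.
Qed.

Lemma normal_closure_normal A : normal (normal_closure A).
Proof.
split; last by move=> x y Nx S [nS AS]; apply: (proj2 nS); apply: Nx.
apply/subgroupP; split=> [S [[/subgroupP[S1 _] _] _] //|x y Nx Ny S SA].
have [[/subgroupP[_ SF] _] _] := SA.
by apply: SF; [apply: Nx | apply: Ny].
Qed.

Lemma generated_subgroup A : subgroup (generated A).
Proof.
apply/subgroupP; split=> [S [/subgroupP[S1 _] _] //|x y Nx Ny S SA].
have [/subgroupP[_ SF] _] := SA.
by apply: SF; [apply: Nx | apply: Ny].
Qed.

Definition commutators A B : set G :=
  generated [set z | exists2 a, A a & exists2 b, B b & z = [~ a, b]].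

(* [lower_central n] is the term gamma_(n+1) of the series. *)
Fixpoint lower_central (n : nat) : set G :=
  if n is m.+1 then commutators (lower_central m) setT else setT.

Definition nilpotent : Prop :=
  exists n, lower_central n = [set 1].

End Subgroups.

Arguments nilpotent : clear implicits.

Definition subgroup_type (G : groupType) (H : set G) (sH : subgroup H) : Type :=
  set_type H.

Section SubgroupType.
Variables (G : groupType) (H : set G) (sH : subgroup H).
HB.instance Definition _ := SubChoice.on (subgroup_type sH).
HB.instance Definition _ :=
  SubChoice_isSubGroup.Build G _ (subgroup_type sH) sH.
End SubgroupType.

Section QuotientGroup.
Variables (G : groupType) (N : set G) (nN : normal N).

Definition coset_rel (x y : G) : bool := `[< N (x^-1 * y) >].

Lemma coset_rel_equiv : equiv_class_of coset_rel.
Proof.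
have [/subgroupP[N1 NF] _] := nN.
have NV x : N x -> N x^-1 by move=> Nx; rewrite -[_^-1]mul1g; apply: NF.
have NM x y : N x -> N y -> N (x * y).
  by move=> Nx /NV Ny; rewrite -[y]invgK; apply: NF.
split=> [x|x y|y x z].
- by apply/asboolP; rewrite mulVg.
- by apply/asboolP/asboolP=> /NV; rewrite invgM invgK.
- move=> /asboolP xy /asboolP yz; apply/asboolP.
  by have := NM _ _ xy yz; rewrite mulgA mulgK.
Qed.

Canonical coset_equiv := EquivRelPack coset_rel_equiv.

Definition quotient_group : Type := {eq_quot coset_equiv}.
HB.instance Definition _ : EqQuotient G coset_equiv quotient_group :=
  EqQuotient.on quotient_group.
HB.instance Definition _ := Choice.on quotient_group.

Definition coset (x : G) : quotient_group := \pi_quotient_group x.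

Lemma coset_eqP x y : coset x = coset y <-> N (x^-1 * y).
Proof.
by split=> [/eqP|Nxy]; [rewrite piE => /asboolP | apply/eqP; rewrite piE; apply/asboolP].
Qed.

Lemma cosetK (u : quotient_group) : coset (repr u) = u.
Proof. exact: reprK. Qed.

Definition quotient_one : quotient_group := coset 1.
Definition quotient_mul (u v : quotient_group) := coset (repr u * repr v).
Definition quotient_inv (u : quotient_group) := coset (repr u)^-1.

Lemma quotient_mulE x y : quotient_mul (coset x) (coset y) = coset (x * y).
Proof.
have [/subgroupP[N1 NF] NJ] := nN.
have NV u : N u -> N u^-1 by move=> Nx; rewrite -[_^-1]mul1g; apply: NF.
have NM u v : N u -> N v -> N (u * v).
  by move=> Nx /NV Ny; rewrite -[v]invgK; apply: NF.
apply/coset_eqP.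
have /coset_eqP hx := cosetK (coset x); have /coset_eqP hy := cosetK (coset y).
have -> : (repr (coset x) * repr (coset y))^-1 * (x * y) =
   ((repr (coset x))^-1 * x) ^ (repr (coset y)) * ((repr (coset y))^-1 * y).
  by rewrite invgM conjgE !mulgA mulgK.
by apply: NM => //; apply: NJ.
Qed.

Lemma quotient_invE x : quotient_inv (coset x) = coset x^-1.
Proof.
have [/subgroupP[N1 NF] NJ] := nN.
have NV u : N u -> N u^-1 by move=> Nx; rewrite -[_^-1]mul1g; apply: NF.
apply/coset_eqP; have /coset_eqP hx := cosetK (coset x).
have := NJ _ x^-1 (NV _ hx).
by rewrite conjgE invgM !invgK !mulgA mulgV mul1g.
Qed.

Lemma quotient_mulA : associative quotient_mul.
Proof.
move=> u v w; rewrite -[u]cosetK -[v]cosetK -[w]cosetK.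
by rewrite !quotient_mulE mulgA.
Qed.

Lemma quotient_mul1g : left_id quotient_one quotient_mul.
Proof. by move=> u; rewrite -[u]cosetK quotient_mulE mul1g. Qed.

Lemma quotient_mulg1 : right_id quotient_one quotient_mul.
Proof. by move=> u; rewrite -[u]cosetK quotient_mulE mulg1. Qed.

Lemma quotient_mulVg : left_inverse quotient_one quotient_inv quotient_mul.
Proof.
by move=> u; rewrite -[u]cosetK quotient_invE quotient_mulE mulVg.
Qed.

Lemma quotient_mulgV : right_inverse quotient_one quotient_inv quotient_mul.
Proof.
by move=> u; rewrite -[u]cosetK quotient_invE quotient_mulE mulgV.
Qed.

HB.instance Definition _ := isGroup.Build quotient_group quotient_mulA
  quotient_mul1g quotient_mulg1 quotient_mulVg quotient_mulgV.

Lemma cosetM : {morph coset : x y / x * y}.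
Proof. by move=> x y; rewrite -quotient_mulE. Qed.

End QuotientGroup.

Definition finite_by_nilpotent (G : groupType) : Prop :=
  exists (N : set G) (nN : normal N),
    finite_set N /\ nilpotent (quotient_group nN).

Definition nilpotent_by_finite (G : groupType) : Prop :=
  exists (N : set G) (nN : normal N),
    nilpotent (subgroup_type (normal_subgroup nN)) /\
    finite_set [set: quotient_group nN].

(* The free product: words in the disjoint union of the two groups, modulo  *)
(* the congruence generated by the multiplication tables of both factors.   *)
Section FreeProduct.
Variables G H : groupType.
Implicit Types u v w : seq (G + H).

Inductive fprod_cong : seq (G + H) -> seq (G + H) -> Prop :=
| fprod_refl u : fprod_cong u u
| fprod_sym u v : fprod_cong u v -> fprod_cong v u
| fprod_trans u v w : fprod_cong u v -> fprod_cong v w -> fprod_cong u w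
| fprod_cat u u' v v' :
    fprod_cong u u' -> fprod_cong v v' -> fprod_cong (u ++ v) (u' ++ v')
| fprod_onel : fprod_cong [:: inl 1] [::]
| fprod_oner : fprod_cong [:: inr 1] [::]
| fprod_mull (x y : G) : fprod_cong [:: inl x; inl y] [:: inl (x * y)]
| fprod_mulr (x y : H) : fprod_cong [:: inr x; inr y] [:: inr (x * y)].

Definition fprod_rel u v : bool := `[< fprod_cong u v >].

Lemma fprod_rel_equiv : equiv_class_of fprod_rel.
Proof.
split=> [u|u v|v u w].
- exact/asboolP/fprod_refl.
- by apply/asboolP/asboolP; apply: fprod_sym.
- by move=> /asboolP uv /asboolP vw; apply/asboolP/(fprod_trans uv).
Qed.

Canonical fprod_equiv := EquivRelPack fprod_rel_equiv.

Definition free_product : Type := {eq_quot fprod_equiv}.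
HB.instance Definition _ : EqQuotient _ fprod_equiv free_product :=
  EqQuotient.on free_product.
HB.instance Definition _ := Choice.on free_product.

Definition fprod_word u : free_product := \pi_free_product u.

Lemma fprod_wordP u v : fprod_word u = fprod_word v <-> fprod_cong u v.
Proof.
by split=> [/eqP|uv]; [rewrite piE => /asboolP | apply/eqP; rewrite piE; apply/asboolP].
Qed.

Lemma fprod_wordK (a : free_product) : fprod_word (repr a) = a.
Proof. exact: reprK. Qed.

Definition letter_inv (l : G + H) : G + H :=
  match l with inl x => inl x^-1 | inr y => inr y^-1 end.

Definition word_inv u := rev (map letter_inv u).

Lemma word_inv_cat u v : word_inv (u ++ v) = word_inv v ++ word_inv u.
Proof. by rewrite /word_inv map_cat rev_cat. Qed.

Lemma word_invK : involutive word_inv.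
Proof.
move=> u; rewrite /word_inv map_rev revK -map_comp -[RHS]map_id.
by apply: eq_map => -[x|x] /=; rewrite invgK.
Qed.

Lemma word_inv_cong u v : fprod_cong u v -> fprod_cong (word_inv u) (word_inv v).
Proof.
elim=> {u v} [u|u v _|u v w _ uv _|u u' v v' _ uu' _ vv'|||x y|x y].
- exact: fprod_refl.
- exact: fprod_sym.
- exact: fprod_trans.
- by rewrite !word_inv_cat; apply: fprod_cat.
- by rewrite /word_inv /= /rev /= invg1; apply: fprod_onel.
- by rewrite /word_inv /= /rev /= invg1; apply: fprod_oner.
- by rewrite /word_inv /= /rev /= invgM; apply: fprod_mull.
- by rewrite /word_inv /= /rev /= invgM; apply: fprod_mulr.
Qed.

Lemma word_mulV u : fprod_cong (u ++ word_inv u) [::].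
Proof.
elim: u => [|l u IH]; first exact: fprod_refl.
rewrite -cat1s word_inv_cat -catA.
have step : fprod_cong ([:: l] ++ u ++ word_inv u ++ word_inv [:: l])
                       ([:: l] ++ word_inv [:: l]).
  apply: fprod_cat; first exact: fprod_refl.
  rewrite catA -[X in fprod_cong _ X]cat0s.
  by apply: fprod_cat => //; apply: fprod_refl.
apply: (fprod_trans step); case: l {step} => x; rewrite /word_inv /rev /=.
  by apply: (fprod_trans (fprod_mull _ _)); rewrite mulgV; apply: fprod_onel.
by apply: (fprod_trans (fprod_mulr _ _)); rewrite mulgV; apply: fprod_oner.
Qed.

Definition fprod_one : free_product := fprod_word [::].
Definition fprod_mul (a b : free_product) := fprod_word (repr a ++ repr b).
Definition fprod_inv (a : free_product) := fprod_word (word_inv (repr a)).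

Lemma fprod_mulE u v :
  fprod_mul (fprod_word u) (fprod_word v) = fprod_word (u ++ v).
Proof. by apply/fprod_wordP/fprod_cat; apply/fprod_wordP/fprod_wordK. Qed.

Lemma fprod_invE u : fprod_inv (fprod_word u) = fprod_word (word_inv u).
Proof. by apply/fprod_wordP/word_inv_cong/fprod_wordP/fprod_wordK. Qed.

Lemma fprod_mulA : associative fprod_mul.
Proof.
move=> a b c; rewrite -[a]fprod_wordK -[b]fprod_wordK -[c]fprod_wordK.
by rewrite !fprod_mulE catA.
Qed.

Lemma fprod_mul1g : left_id fprod_one fprod_mul.
Proof. by move=> a; rewrite -[a]fprod_wordK fprod_mulE. Qed.

Lemma fprod_mulg1 : right_id fprod_one fprod_mul.
Proof. by move=> a; rewrite -[a]fprod_wordK fprod_mulE cats0. Qed.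

Lemma fprod_mulgV : right_inverse fprod_one fprod_inv fprod_mul.
Proof.
move=> a; rewrite -[a]fprod_wordK fprod_invE fprod_mulE.
exact/fprod_wordP/word_mulV.
Qed.

Lemma fprod_mulVg : left_inverse fprod_one fprod_inv fprod_mul.
Proof.
move=> a; rewrite -[a]fprod_wordK fprod_invE fprod_mulE; apply/fprod_wordP.
by rewrite -[X in _ ++ X]word_invK; apply: word_mulV.
Qed.

HB.instance Definition _ := isGroup.Build free_product fprod_mulA
  fprod_mul1g fprod_mulg1 fprod_mulVg fprod_mulgV.

Definition fprod_inl (x : G) : free_product := fprod_word [:: inl x].
Definition fprod_inr (y : H) : free_product := fprod_word [:: inr y].

Lemma fprod_inlM : {morph fprod_inl : x y / x * y}.
Proof.
move=> x y; symmetry; apply: etrans (fprod_mulE _ _) _.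
exact/fprod_wordP/fprod_mull.
Qed.

Lemma fprod_inrM : {morph fprod_inr : x y / x * y}.
Proof.
move=> x y; symmetry; apply: etrans (fprod_mulE _ _) _.
exact/fprod_wordP/fprod_mulr.
Qed.

End FreeProduct.

Section Nu.
Variable G : groupType.

(* The second factor of the free product plays the role of the isomorphic   *)
(* copy of G, and [fprod_inr] that of the isomorphism onto it.              *)
Let i : G -> free_product G G := @fprod_inl G G.
Let phi : G -> free_product G G := @fprod_inr G G.

(* A relation l = r is encoded by the relator l / r. *)
Definition nu_relators : set (free_product G G) :=
  [set r | exists g h k : G,
     r = [~ i g, phi h] ^ i k / [~ i (g ^ k), phi (h ^ k)] \/
     r = [~ i g, phi h] ^ phi k / [~ i (g ^ k), phi (h ^ k)]].

Definition nu : Type := quotient_group (normal_closure_normal nu_relators).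
HB.instance Definition _ := Group.on nu.

Definition nu_inl (g : G) : nu := coset (normal_closure_normal nu_relators) (i g).
Definition nu_phi (g : G) : nu := coset (normal_closure_normal nu_relators) (phi g).

Definition upsilon : set nu := commutators (range nu_inl) (range nu_phi).

Lemma upsilon_subgroup : subgroup upsilon.
Proof. exact: generated_subgroup. Qed.

(* The non-abelian tensor square, through its canonical identification      *)
(* g (x) h |-> [g, h^phi] with the subgroup [G, G^phi] of nu(G).            *)
Definition tensor_square : Type := subgroup_type upsilon_subgroup.
HB.instance Definition _ := SubGroup.on tensor_square.

End Nu.

(* Main.v *)
From HB Require Import structures.
Require Import Defs.
From mathcomp Require Import all_boot.
From mathcomp Require Import boolp classical_sets functions cardinality.

(** Up to a central subgroup, nu(G) is a subgroup of G x G x G.  There are three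
homomorphisms from nu(G) to G: the two that kill one of the two copies of G, and
the fold map, which identifies both copies with G.  An element in the kernel of
all three is central in nu(G) ([nu_joint_kernel_central]).

Centrality rests on two facts about Upsilon = [G, G^phi].  It is the kernel of
the pair of projections onto G x G ([upsilon_kernel]), and any x in nu(G)
conjugates Upsilon as the fold of x does ([upsilon_conj_fold]).  Expanding
[a^b, k^phi] in two ways then gives [t, k^phi] = [fold t, k^phi] for t in
Upsilon ([upsilon_commg_phi]); if the fold of t is trivial, then t commutes
with G^phi, hence with G, which acts on Upsilon in the same way.

The rest is the dictionary between the lower and the upper central series of an
arbitrary group.  By a theorem of P. Hall ([hall_upper_central]), a
finite-by-nilpotent group has a term Z_n of its upper central series of finite
index.  The preimage of Z_n(G)^3 under the three homomorphisms has finite index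
in nu(G) and lies in Z_(n+1)(nu(G)), because the joint kernel is central
([nu_upper_central]).  So Z_(n+1)(nu(G)) is a nilpotent normal subgroup of
finite index: nu(G) is nilpotent-by-finite.  By the converse theorem of Baer
([baer_lower_central]), some term of the lower central series of nu(G) is
finite.  The corresponding term for the subgroup Upsilon is contained in it,
so it is finite too, and the tensor square is finite-by-nilpotent. *)

Set Implicit Arguments.
Unset Strict Implicit.
Unset Printing Implicit Defensive.

Local Open Scope classical_set_scope.
Local Open Scope group_scope.

(** * Subgroups, commutators and the two central series *)

Section SubgroupTheory.
Variable G : groupType.
Implicit Types (A H N : set G) (x y g : G).

Lemma subgroup_one H : subgroup H -> H 1.
Proof. by case/subgroupP. Qed.

Lemma subgroup_div H x y : subgroup H -> H x -> H y -> H (x / y).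
Proof. by case/subgroupP=> _; apply. Qed.

Lemma subgroup_inv H x : subgroup H -> H x -> H x^-1.
Proof.
by move=> sH Hx; rewrite -div1g; apply: (subgroup_div sH (subgroup_one sH)).
Qed.

Lemma subgroup_mul H x y : subgroup H -> H x -> H y -> H (x * y).
Proof.
move=> sH Hx Hy; rewrite -[y]invgK; apply: (subgroup_div sH) => //.
exact: (subgroup_inv sH).
Qed.

Lemma normal_commgl N x y : normal N -> N x -> N [~ x, y].
Proof.
move=> [sN NJ] Nx; rewrite commgEl; apply: (subgroup_mul sN) => //.
  exact: (subgroup_inv sN).
exact: NJ.
Qed.

Lemma sub_generated A H : subgroup H -> A `<=` H -> generated A `<=` H.
Proof. exact: smallest_sub. Qed.

Lemma sub_normal_closure A N : normal N -> A `<=` N -> normal_closure A `<=` N.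
Proof. exact: smallest_sub. Qed.

Lemma commg_divl x y z : [~ x / y, z] = ([~ x, z] / [~ y, z]) ^ y^-1.
Proof. by rewrite /commg /conjg !gnorm. Qed.

Lemma commg_mulr x y z : [~ x, y * z] = [~ x, z] * [~ x, y] ^ z.
Proof. by rewrite /commg /conjg !gnorm. Qed.

Lemma commg_mull x y z : [~ x * y, z] = [~ x, z] ^ y * [~ y, z].
Proof. by rewrite /commg /conjg !gnorm. Qed.

Lemma commg_divl_commute x y z : commute (x / y) z -> [~ x, z] = [~ y, z].
Proof.
move=> /commgP/eqP xyz; rewrite -[x](divgK y) commg_mull xyz.
by rewrite conj1g mul1g.
Qed.

Lemma commg_divr_commute x y z : commute x (y / z) -> [~ x, y] = [~ x, z].
Proof.
move=> /commgP/eqP xyz; rewrite -[y](divgK z) commg_mulr xyz.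
by rewrite conj1g mulg1.
Qed.

Definition centralizer A : set G := [set x | forall a, A a -> commute a x].

Lemma centralizer_subgroup A : subgroup (centralizer A).
Proof.
apply/subgroupP; split=> [a _|x y Cx Cy a Aa]; first exact: commute1.
by apply: commuteM; [apply: Cx | apply: commuteV; apply: Cy].
Qed.

End SubgroupTheory.

Section LowerCentral.
Variable G : groupType.
Implicit Types (H N : set G) (x y g : G).

Lemma lower_central_commg n x y :
  lower_central n x -> lower_central n.+1 [~ x, y].
Proof. by move=> lx; apply: sub_gen_smallest; exists x => //; exists y. Qed.

Lemma sub_lower_centralS n H :
    subgroup H -> (forall x y, lower_central n x -> H [~ x, y]) ->
  @lower_central G n.+1 `<=` H.
Proof.
by move=> sH HR; apply: sub_generated => // _ [x lx [y _ ->]]; apply: HR.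
Qed.

Lemma lower_central_normal n : normal (@lower_central G n).
Proof.
elim: n => [|n [_ IHJ]]; first by split=> //; apply/subgroupP.
have sn : subgroup (@lower_central G n.+1) by exact: generated_subgroup.
split=> // x y lx.
suff/(_ x lx y) : lower_central n.+1 `<=`
  [set z | forall g : G, lower_central n.+1 (z ^ g)] by [].
apply: sub_lower_centralS => [|a b la g]; last first.
  by rewrite conjRg; apply: lower_central_commg; apply: IHJ.
apply/subgroupP; split=> [g|a b la lb g].
  by rewrite conj1g; apply: (subgroup_one sn).
by rewrite conjMg conjVg; apply: (subgroup_div sn).
Qed.

End LowerCentral.

Section UpperCentral.
Variable G : groupType.
Implicit Types (x y g : G).

Fixpoint upper_central (n : nat) : set G :=
  if n is m.+1 then [set x | forall g, upper_central m [~ x, g]] else [set 1].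

Lemma upper_central_normal n : normal (upper_central n).
Proof.
elim: n => [|n [sn nJ]] /=.
  split=> [|x y ->]; last by rewrite /= conj1g.
  by apply/subgroupP; split=> // x y -> ->; rewrite /= divg1.
split=> [|x y ux g].
  apply/subgroupP; split=> [g|x y ux uy g].
    by rewrite comm1g; apply: (subgroup_one sn).
  by rewrite commg_divl; apply: nJ; apply: (subgroup_div sn).
by rewrite -[g](conjgKV y) -conjRg; apply: nJ.
Qed.

Lemma upper_central_subgroup n : subgroup (upper_central n).
Proof. by case: (upper_central_normal n). Qed.

Lemma upper_central1P x : upper_central 1 x <-> forall g, commute x g.
Proof.
split=> [ux g|xC g]; first by apply/commgP/eqP/ux.
exact/eqP/commgP/xC.
Qed.

End UpperCentral.

Section Coset.
Variables (G : groupType) (N : set G) (nN : normal N).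

HB.instance Definition _ :=
  isUMagmaMorphism.Build G (quotient_group nN) (coset nN) (erefl, cosetM nN).

Lemma coset_surj (u : quotient_group nN) : exists x, coset nN x = u.
Proof. by exists (repr u); apply: cosetK. Qed.

Lemma coset_eq1 x : coset nN x = 1 <-> N x.
Proof.
rewrite -(gmulf1 (s := coset nN)); split=> [/esym/coset_eqP|Nx].
  by rewrite invg1 mul1g.
by apply/esym/coset_eqP; rewrite invg1 mul1g.
Qed.

End Coset.

Section Morphisms.
Variables (G Q : groupType) (f : UMagmaMorphism.type G Q).

Lemma morph_lower_central n x : lower_central n x -> lower_central n (f x).
Proof.
elim: n x => [//|n IHn] x.
apply: (@sub_lower_centralS _ _ [set x | lower_central n.+1 (f x)])
  => /= [|a b la].
  have [sn _] := lower_central_normal Q n.+1.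
  apply/subgroupP; split=> [|a b la lb] /=.
    by rewrite gmulf1; apply: (subgroup_one sn).
  by rewrite gmulfF; apply: (subgroup_div sn).
by rewrite /= gmulfR; apply: lower_central_commg; apply: IHn.
Qed.

Lemma kernel_normal : normal [set x | f x = 1].
Proof.
split=> [|x y /= fx]; last by rewrite gmulfJ fx conj1g.
apply/subgroupP; split=> [|x y /= fx fy]; first exact: gmulf1.
by rewrite gmulfF fx fy divgg.
Qed.

Hypothesis f_surj : forall u, exists x, f x = u.

Lemma lower_central_lift n u :
  lower_central n u -> exists2 x, lower_central n x & f x = u.
Proof.
elim: n u => [u _|n IHn u].
  by have [x <-] := f_surj u; exists x.
apply: (@sub_lower_centralS _ _
  [set u | exists2 x, lower_central n.+1 x & f x = u]) => /= [|a b la].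
  have [sn _] := lower_central_normal G n.+1.
  apply/subgroupP; split=> /= [|_ _ [x lx <-] [y ly <-]].
    by exists 1; [apply: (subgroup_one sn)|rewrite gmulf1].
  by exists (x / y); [apply: (subgroup_div sn)|rewrite gmulfF].
have [x lx <-] := IHn _ la; have [y <-] := f_surj b.
by exists [~ x, y]; [apply: lower_central_commg|rewrite gmulfR].
Qed.

(** The n-th centre of a quotient by a subgroup of the k-th centre pulls back
into the (n + k)-th centre. *)
Lemma upper_central_preim k :
    (forall x, f x = 1 -> upper_central k x) ->
  forall n x, upper_central n (f x) -> upper_central (n + k) x.
Proof.
move=> fk; elim=> [x|n IHn x] /=; first exact: fk.
by move=> ux g; apply: IHn; rewrite gmulfR.
Qed.

(** Killing the centre shifts the upper central series by one. *)
Lemma upper_central_im :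
    (forall x, upper_central 1 x -> f x = 1) ->
  forall n x, upper_central n.+1 x -> upper_central n (f x).
Proof.
move=> f1; elim=> [x /f1 //|n IHn x ux u].
by have [g <-] := f_surj u; rewrite -gmulfR; apply/IHn/ux.
Qed.

End Morphisms.

(** * Finite index *)

Section FiniteIndex.
Variable G : groupType.
Implicit Types (A H : set G) (x y t : G).

Definition finite_index A H : Prop :=
  exists s : seq G, forall x, A x -> exists2 t, t \in s & H (x / t).

(** Keeping one element of A for each value of f gives the representatives. *)
Lemma finite_indexP A H T (f : G -> T) :
    finite_set (f @` A) ->
    (forall x y, A x -> A y -> f x = f y -> H (x / y)) ->
  finite_index A H.
Proof.
move=> fin_f fH; pose rep c := xget 1 [set t | A t /\ f t = c].
have repP x : A x -> A (rep (f x)) /\ f (rep (f x)) = f x.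
  by move=> Ax; apply: (@xgetI _ 1 [set t | A t /\ f t = f x] x).
have /finite_seqP[s sE] : finite_set (rep @` (f @` A)) by exact: finite_image.
exists s => x Ax; have [Ar fr] := repP _ Ax; exists (rep (f x)); last exact: fH.
suff : [set` s] (rep (f x)) by [].
by rewrite -sE; exists (f x) => //; exists x.
Qed.

(** The form in which finite index is combined along several homomorphisms:
functions with finite image are closed under pairing. *)
Lemma finite_index_map A H : subgroup H -> finite_index A H ->
  exists2 r : G -> G, finite_set (r @` A) &
    forall x y, A x -> A y -> r x = r y -> H (x / y).
Proof.
move=> sH [s sP]; pose r x := xget 1 [set t | t \in s /\ H (x / t)].
have rP x : A x -> r x \in s /\ H (x / r x).
  by move=> /sP[t ts Ht]; apply: (@xgetI _ 1 [set t | t \in s /\ H (x / t)] t).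
exists r => [|x y Ax Ay rxy].
  apply: (@sub_finite_set _ _ [set` s]); last exact: finite_seq.
  by move=> _ [x Ax <-]; case: (rP x Ax).
have [_ Hx] := rP x Ax; have [_ Hy] := rP y Ay.
by rewrite rxy in Hx; have := subgroup_div sH Hx Hy; rewrite mulgKA.
Qed.

(** If every t in a finite list has finitely many conjugates under A, then x is
determined modulo the centralizer by the list of the conjugates t ^ x. *)
Lemma finite_index_centralizer A (s : seq G) :
    subgroup A ->
    {in s, forall t, finite_set ((fun x => t ^ x) @` A)} ->
  finite_index A (A `&` centralizer [set` s]).
Proof.
move=> sA fs; apply: (@finite_indexP _ _ _ (fun x => [seq t ^ x | t <- s])).
  elim: s fs => [|t s IHs] fs.
    apply: (@sub_finite_set _ _ [set [::]]); last exact: finite_set1.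
    by move=> _ [x _ <-].
  have fin_t := fs t (mem_head _ _).
  have {}IHs := IHs (fun u us => fs u (@mem_behead _ (t :: s) u us)).
  apply: sub_finite_set (finite_image2 cons fin_t IHs).
  move=> _ [x Ax <-]; exists (t ^ x); first by exists x.
  by exists [seq t ^ x | t <- s] => //; exists x.
move=> x y Ax Ay xy; split; first exact: (subgroup_div sA).
move=> t ts; apply/commgP/conjg_fixP; rewrite conjgM.
by have /eq_in_map/(_ t ts) -> := xy; rewrite conjgK.
Qed.

End FiniteIndex.

(** * From the lower central series to the upper one *)

Lemma finite_conj_orbit (G : groupType) (Z N : set G) t :
    finite_set N -> (forall x, Z x -> N [~ t, x]) ->
  finite_set ((fun x => t ^ x) @` Z).
Proof.
move=> fN ZN; apply: sub_finite_set (finite_image (fun n => t * n) fN).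
by move=> _ [x Zx <-]; exists [~ t, x]; [apply: ZN|rewrite /commg mulVKg].
Qed.

Lemma centralizer_normal (G : groupType) (N : set G) :
  normal N -> normal (centralizer N).
Proof.
move=> [_ NJ]; split=> [|x y Cx n Nn]; first exact: centralizer_subgroup.
have := Cx _ (NJ _ y^-1 Nn) => /(congr1 (conjg^~ y)).
by rewrite /= conjMg (conjMg x) conjgKV.
Qed.

(** Writing any h as c * t with c centralizing N and t in the transversal T, one
finds that x, which commutes with N and T, satisfies [[x, g], h] = [x, [g, t]]
up to conjugation whenever g centralizes N.  So commutating [x, g] with elements
of G amounts to moving g down the lower central series, and once g has reached N
the result is trivial. *)
Lemma centralizing_upper_central (G : groupType) (c : nat)
    (N : set G) (T : seq G) x :
    normal N -> @lower_central G c `<=` N ->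
    (forall g, exists2 t, t \in T & centralizer N (g / t)) ->
    (forall g, N [~ x, g]) ->
    centralizer N x -> {in T, forall t, commute t x} ->
  upper_central c.+1 x.
Proof.
move=> nN lcN TC xN xCN xCT.
have nC := centralizer_normal nN.
have descend j : j <= c -> forall g,
    centralizer N g -> lower_central (c - j) g -> upper_central j [~ x, g].
  elim: j => [_ g _|j IHj jc g Cg lg h].
    by rewrite subn0 => /lcN Ng; apply/eqP/commgP/commute_sym/xCN.
  have [t tT Cht] := TC h; set u := [~ x, g].
  have Nu : N u by apply: xN.
  rewrite (commg_divr_commute (Cht _ Nu)).
  have Cgt : centralizer N [~ g, t] by exact: (normal_commgl _ nC Cg).
  have xt : x ^ t = x by apply/conjg_fixP/commgP/commute_sym/xCT.
  have ut : u ^ t = [~ x, [~ g, t]] * u.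
    have -> : u ^ t = [~ x, g * [~ g, t]] by rewrite /u conjRg xt /commg mulVKg.
    rewrite commg_mulr; congr (_ * _).
    by apply/conjg_fixP/commgP; exact: (Cgt _ Nu).
  rewrite commgEl ut -conjgE.
  have [_ uJ] := upper_central_normal G j.
  apply/uJ/IHj => //; first exact: ltnW.
  by rewrite -subnSK //; apply: lower_central_commg.
move=> h; have [t tT Cht] := TC h; rewrite -[h](divgK t).
rewrite commg_mulr.
have /eqP -> : [~ x, t] == 1 by apply/commgP/commute_sym/xCT.
have [_ cJ] := upper_central_normal G c.
by rewrite mul1g; apply/cJ/descend => //; rewrite subnn.
Qed.

(** Induction on c.  Let Z be the preimage of the centre of G / N, which
contains [lower_central c].  Every element of G has finitely many conjugates
under Z, and the centralizer of the finite subgroup N has a finite transversal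
T; hence the centralizer of T and N in Z has finite index in Z, and it lies in a
higher centre ([centralizing_upper_central]).  Modulo that higher centre Z
becomes a finite normal subgroup, and the induction hypothesis applies. *)
Lemma hall_upper_central (G : groupType) (c : nat) (N : set G) :
    normal N -> finite_set N -> @lower_central G c `<=` N ->
  exists m, finite_index setT (@upper_central G m).
Proof.
elim: c G N => [|c IHc] G N nN fN lcN.
  exists 0%N; apply: (finite_indexP (f := id)) => [|x y _ _ /= ->].
    by rewrite image_id; apply: sub_finite_set fN.
  by rewrite divgg.
have [sN NJ] := nN.
pose Z : set G := [set x | forall g, N [~ x, g]].
have sZ : subgroup Z.
  apply/subgroupP; split=> [g|x y Zx Zy g].
    by rewrite comm1g; apply: (subgroup_one sN).
  by rewrite commg_divl; apply/NJ/(subgroup_div sN).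
have nZ : normal Z.
  split=> // x y Zx g; rewrite -[g](conjgKV y) -conjRg; exact/NJ/Zx.
have lcZ : @lower_central G c `<=` Z.
  by move=> x lx g; apply: lcN; apply: lower_central_commg.
have /finite_seqP[L NE] := fN.
have [T TC] : exists T : seq G,
    forall g, exists2 t, t \in T & centralizer N (g / t).
  have sT : subgroup [set: G] by apply/subgroupP.
  have := @finite_index_centralizer G setT L sT.
  case=> [t ts|T TP]; last first.
    by exists T => g; have [//|t tT [_]] := TP g; rewrite -NE; exists t.
  apply: sub_finite_set fN => _ [x _ <-]; apply: NJ.
  by rewrite NE.
have [S SP] : finite_index Z (Z `&` centralizer [set` T ++ L]).
  apply: finite_index_centralizer => // t _; apply: (finite_conj_orbit fN).
  by move=> x Zx; rewrite -invgR; apply/(subgroup_inv sN)/Zx.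
have DU : Z `&` centralizer [set` T ++ L] `<=` upper_central c.+2.
  move=> x [Zx Cx]; apply: (@centralizing_upper_central _ _ N T) => //.
    move=> n; rewrite NE => Nn; apply: Cx.
    by rewrite /= mem_cat [n \in L]Nn orbT.
  by move=> t tT; apply: Cx; rewrite /= mem_cat tT.
pose nU := upper_central_normal G c.+2.
pose f : UMagmaMorphism.type G _ := coset nU.
have fsurj := @coset_surj _ _ nU.
have [|||m [s sP]] := IHc (quotient_group nU) (f @` Z).
- split; last first.
    move=> _ y [x Zx <-]; have [z <-] := fsurj y.
    by exists (x ^ z); [case: nZ => _; apply|rewrite gmulfJ].
  apply/subgroupP; split=> [|_ _ [x Zx <-] [y Zy <-]].
    by exists 1; [apply: (subgroup_one sZ)|rewrite gmulf1].
  by exists (x / y); [apply: (subgroup_div sZ)|rewrite gmulfF].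
- apply: sub_finite_set (finite_seq (map f S)) => _ [x Zx <-].
  have [t tS Ht] := SP x Zx; apply/mapP; exists t => //.
  by apply/divg1_eq; rewrite -gmulfF; apply/coset_eq1/DU.
- by move=> u /(lower_central_lift fsurj)[x /lcZ Zx <-]; exists x.
exists (m + c.+2)%N.
exists (map repr s) => x _.
have [//|t ts Ht] := sP (f x); exists (repr t); first exact: map_f.
apply: (upper_central_preim (f := f)) => [y|]; first by move/coset_eq1.
by rewrite gmulfF [f (repr t)]cosetK.
Qed.

(** * From the upper central series back to the lower one *)

(** For x in [lower_central n], y arbitrary and z in Z_(n+2), working modulo the
centre shows that [z, x] is central, while [z, y] lies in Z_(n+1) and so
commutes with x.  Hence z has the same conjugate by x y and by y x, and so
commutes with [x, y]. *)
Lemma lower_upper_commute (G : groupType) n (x z : G) :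
  lower_central n x -> upper_central n.+1 z -> commute x z.
Proof.
elim: n G x z => [|n IHn] G x z;
  first by move=> _ /upper_central1P zC; apply/commute_sym/zC.
move=> + uz; suff sub :
  @lower_central G n.+1 `<=` centralizer (upper_central n.+2).
  by move/sub/(_ z uz)/commute_sym.
move=> {x z uz}; apply: sub_lower_centralS => [|x y lx z uz].
  exact: centralizer_subgroup.
have nU := upper_central_normal G 1.
pose f : UMagmaMorphism.type G _ := coset nU.
have f_surj := @coset_surj _ _ nU.
have f_one (t : G) : upper_central 1 t -> f t = 1 by move=> ut; apply/coset_eq1.
have swap t : upper_central n.+2 t -> t ^ (x * y) = t ^ (y * x).
  move=> ut.
  have cx : forall g, commute [~ t, x] g.
    apply/upper_central1P/(@coset_eq1 _ _ nU).
    rewrite -[coset _]/(f : G -> _) gmulfR.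
    apply/eqP/commgP/commute_sym/IHn; first exact: morph_lower_central.
    exact: upper_central_im.
  have cy : commute x [~ t, y] by apply: IHn => //; apply: ut.
  have tE g : t ^ g = t * [~ t, g] by rewrite commgEl mulVKg.
  have xy : [~ t, x] ^ y = [~ t, x] by apply/conjg_fixP/commgP.
  have yx : [~ t, y] ^ x = [~ t, y] by apply/conjg_fixP/commgP/commute_sym.
  rewrite !conjgM !tE (conjMg t _ y) (conjMg t _ x) xy yx !tE.
  by rewrite -[LHS]mulgA -cx mulgA.
have [_ UJ] := upper_central_normal G n.+2.
apply/commgP/conjg_fixP.
have -> : [~ x, y] = (y * x)^-1 * (x * y) by rewrite /commg /conjg !gnorm.
rewrite conjgM swap; last exact: UJ.
by rewrite conjgKV.
Qed.

Lemma conjgg (G : groupType) (x : G) : x ^ x = x.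
Proof. by rewrite conjgE mulKg. Qed.

(** When a power of [a, b] commutes with b, the next power is a product of one
commutator fewer; this is the shortening step of Schur's theorem. *)
Lemma commg_expS (G : groupType) n (a b : G) : commute ([~ a, b] ^+ n.+1) b ->
  [~ a, b] ^+ n.+2 = [~ a, b ^+ 2] * [~ a ^ b, b] ^+ n.
Proof.
have -> : [~ a ^ b, b] = [~ a, b] ^ b by rewrite conjRg conjgg.
rewrite -conjXg !expgS; move: ([~ a, b] ^+ n) => c cb.
have -> : [~ a, b] * ([~ a, b] * c) = a^-1 * b^-1 * a * (b * ([~ a, b] * c)).
  by rewrite {1}/commg /conjg !mulgA.
by rewrite -cb /commg /conjg !gnorm.
Qed.

Lemma finite_words (G : groupType) (s : seq G) n :
  finite_set [set w : seq G | (size w <= n)%N /\ {subset w <= s}].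
Proof.
elim: n => [|n IHn].
  apply: (@sub_finite_set _ _ [set [::]]); last exact: finite_set1.
  by move=> w [/=]; rewrite leqn0 size_eq0 => /eqP.
have fin1 : finite_set [set [::] : seq G] by exact: finite_set1.
have finS := finite_image2 cons (finite_seq s) IHn.
have := conj fin1 finS; rewrite -finite_setU; apply: sub_finite_set.
move=> [|a w] [/= sw ws]; [by left|right].
exists a; first by apply: ws; apply: mem_head.
by exists w => //; split=> // b bw; apply: ws; rewrite inE bw orbT.
Qed.

Lemma size_count_bound (T : eqType) (s w : seq T) n :
    {subset w <= s} -> {in s, forall x, (count_mem x w <= n)%N} ->
  (size w <= size s * n)%N.
Proof.
elim: s w => [|x s IHs] w ws wn.
  by case: w ws {wn} => // a w /(_ a (mem_head _ _)).
rewrite -(count_predC (pred1 x)) /= mulSn; apply: leq_add.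
  by apply: wn; apply: mem_head.
rewrite -size_filter; apply: IHs => [a|a sa].
  by rewrite mem_filter => /andP[/= ax /ws]; rewrite inE (negPf ax).
apply: leq_trans (wn a _); last by rewrite inE sa orbT.
by rewrite count_filter; apply: sub_count => b /andP[].
Qed.

(** Moving an occurrence of x to the front conjugates the letters that it passes
by x, which fixes the other occurrences of x. *)
Lemma prod_pull (G : groupType) (s : seq G) (x : G) n w :
    {in s &, forall a b, a ^ b \in s} ->
    {subset w <= s} -> (n <= count_mem x w)%N ->
  exists w', [/\ {subset w' <= s}, (size w' + n = size w)%N &
    \prod_(a <- w) a = x ^+ n * \prod_(a <- w') a].
Proof.
move=> sJ; elim: n w => [|n IHn] w ws nw.
  by exists w; rewrite mul1g addn0.
have xw : x \in w by rewrite -has_pred1 has_count (leq_trans _ nw).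
have xs := ws _ xw.
case/splitPr: w / xw ws nw => w1 w2 ws nw.
have [||w' [w's sz E]] := IHn ([seq a ^ x | a <- w1] ++ w2).
- move=> a; rewrite mem_cat => /orP[/mapP[b bw ->]|aw2].
    by apply: sJ => //; apply: ws; rewrite mem_cat bw.
  by apply: ws; rewrite mem_cat inE aw2 !orbT.
- move: nw; rewrite !count_cat /= eqxx addnCA add1n ltnS => /leq_trans; apply.
  rewrite leq_add2r count_map; apply: sub_count => a /= /eqP->.
  by rewrite conjgE mulKg.
exists w'; split=> //.
  by move: sz; rewrite !size_cat size_map /= !addnS => ->.
rewrite big_cat big_cons /= expgS -mulgA -E big_cat /= big_map -conjg_prod.
by rewrite mulgA [RHS]mulgA -conjgC.
Qed.

(** A shortest word for an element of the generated subgroup cannot contain the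
same letter more than n times: these occurrences could be gathered into a power
and replaced by a shorter word.  So its length is at most n times the number of
letters. *)
Lemma finite_generated (G : groupType) (s : seq G) n :
    {in s &, forall a b, a ^ b \in s} -> {in s, forall a, a^-1 \in s} ->
    {in s, forall a, exists w : seq G,
      [/\ {subset w <= s}, (size w <= n)%N & a ^+ n.+1 = \prod_(b <- w) b]} ->
  finite_set (generated [set` s]).
Proof.
move=> sJ sV sX.
pose W := [set w : seq G | (size w <= size s * n)%N /\ {subset w <= s}].
suff short (w : seq G) : {subset w <= s} ->
    exists2 w', W w' & \prod_(a <- w) a = \prod_(a <- w') a.
  have finW := finite_words s (size s * n).
  apply: sub_finite_set (finite_image (fun w => \prod_(a <- w) a) finW).
  apply: sub_generated => [|a sa]; last first.
    have [|w Ww E] := short [:: a]; first by move=> b; rewrite inE => /eqP->.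
    by exists w => //; rewrite -E big_seq1.
  apply/subgroupP; split=> [|_ _ [u [_ us] <-] [v [_ vs] <-]].
    by exists [::]; rewrite ?big_nil //; split.
  have [|w Ww E] := short (u ++ rev (map (fun a => a^-1) v)).
    move=> a; rewrite mem_cat mem_rev => /orP[/us //|/mapP[b /vs bs ->]].
    exact: sV.
  by exists w => //; rewrite -E big_cat /= -map_rev big_map prodgV revK.
have [m] := ubnP (size w); elim: m w => // m IHm w; rewrite ltnS => wm ws.
have [small|large] := leqP (size w) (size s * n); first by exists w.
have [x xs xn] : exists2 x, x \in s & (n < count_mem x w)%N.
  apply/hasP/negPn; rewrite -all_predC; apply/negP => /allP few.
  move: large; rewrite ltnNge size_count_bound // => x /few /=.
  by rewrite -leqNgt.
have [w' [w's sz ->]] := prod_pull sJ ws xn.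
have [v [vs vn ->]] := sX x xs.
rewrite -big_cat; apply: IHm => [|a]; last by rewrite mem_cat => /orP[/vs|/w's].
by rewrite size_cat; apply: leq_trans wm; rewrite -sz addnC ltn_add2l ltnS.
Qed.

Lemma expg_fact (Q : groupType) (r : seq Q) (y : Q) :
  (forall i, y ^+ i \in r) -> y ^+ (size r)`! = 1.
Proof.
move=> yr; have /(uniqPn 1)[i [j [ij]]] :
    ~~ uniq (mkseq (fun i => y ^+ i) (size r).+1).
  apply/negP => /uniq_leq_size le.
  suff : ((size r).+1 <= size r)%N by rewrite ltnn.
  rewrite -[X in (X <= _)%N](size_mkseq (fun i => y ^+ i)); apply: le => a.
  by move=> /mapP[i _ ->].
rewrite size_mkseq => jr; rewrite !nth_mkseq //; last exact: ltn_trans jr.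
move=> yij; have /dvdnP[q ->] : (j - i %| (size r)`!)%N.
  apply: dvdn_fact; rewrite subn_gt0 ij /= leq_subLR.
  exact: leq_trans (leq_addl _ _).
have y1 : y ^+ (j - i) = 1 by rewrite expgnFr ?(ltnW ij) // yij divgg.
by rewrite mulnC expgnA y1 expg1n.
Qed.

(** Induction on k: let Z_(k+1) have finite index and L be [lower_central k].
The induction hypothesis for the quotient by the centre shows that L is finite
modulo the centre, and L commutes with Z_(k+1) ([lower_upper_commute]).  So
there are only finitely many commutators [l, g] with l in L and g in G, and they
generate [lower_central k.+1].  They lie in L, so a fixed power of each of them
is central, and [commg_expS] shortens the next power. *)
Lemma baer_lower_central (G : groupType) k :
  finite_index setT (@upper_central G k) -> finite_set (@lower_central G k).
Proof.
elim: k G => [|k IHk] G [s sP].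
  apply: sub_finite_set (finite_seq s) => x _.
  by have [//|t ts /divg1_eq->] := sP x.
have nU := upper_central_normal G 1.
pose f : UMagmaMorphism.type G _ := coset nU.
have f_surj := @coset_surj _ _ nU.
have fK (t : G) : f t = 1 <-> upper_central 1 t by apply: coset_eq1.
have fR (x y : G) : f x = f y -> forall g, commute (x / y) g.
  by move=> fxy; apply/upper_central1P/fK; rewrite gmulfF fxy divgg.
have /finite_seqP[r rE] : finite_set (@lower_central (quotient_group nU) k).
  apply: IHk; exists (map f s) => u _.
  have [x <-] := f_surj u; have [//|t ts ut] := sP x.
  exists (f t); first exact: map_f.
  by rewrite -gmulfF; apply: upper_central_im => // y /fK.
have lfr (x : G) : lower_central k x -> f x \in r.
  move=> lx; suff : [set` r] (f x) by [].
  by rewrite -rE; apply: morph_lower_central.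
pose S := [set z | exists2 x : G, lower_central k x &
  exists2 g, setT g & z = [~ x, g]].
(* [x, g] depends only on x modulo the centre and on g modulo Z_(k+1) *)
have /finite_seqP[c cE] : finite_set S.
  pose rep u := xget 1 [set x : G | lower_central k x /\ f x = u].
  have repP (x : G) : lower_central k x ->
      lower_central k (rep (f x)) /\ f (rep (f x)) = f x.
    move=> lx.
    exact: (@xgetI _ 1 [set y : G | lower_central k y /\ f y = f x] x).
  have fin := finite_image2 (fun u t => [~ rep u, t])
    (finite_seq r) (finite_seq s).
  apply: sub_finite_set fin.
  move=> _ [x lx [g _ ->]]; have [//|t ts gt] := sP g.
  have [ly fy] := repP x lx; exists (f x); first exact: lfr.
  exists t => //; rewrite (commg_divl_commute (fR _ _ (esym fy) g)).
  by apply/esym/commg_divr_commute; apply: lower_upper_commute gt.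
have [sl lJ] := lower_central_normal G k.
have lcR (x y : G) : lower_central k x -> lower_central k [~ x, y].
  by move=> lx; apply: (normal_commgl _ (lower_central_normal G k) lx).
rewrite /= /commutators -/S cE.
have inc (z : G) : (z \in c) <-> S z by rewrite cE.
have [n nP] : exists n, forall x : G, lower_central k x ->
    forall g, commute (x ^+ n.+1) g.
  exists (size r)`!.-1 => x lx; apply/upper_central1P/fK.
  rewrite prednK ?fact_gt0 // gmulfXn; apply: expg_fact => i.
  rewrite -gmulfXn; apply: lfr.
  elim: i => [|i IHi]; first exact: (subgroup_one sl).
  by rewrite expgS; apply: (subgroup_mul sl).
apply: (@finite_generated _ _ n.+1) => [a b|a|a].
- move=> /inc[x lx [y _ ->]] _; apply/inc; rewrite conjRg.
  by exists (x ^ b); [apply: lJ|exists (y ^ b)].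
- (* [x, y]^-1 = [x ^ y, y^-1] *)
  move=> /inc[x lx [y _ ->]]; apply/inc; exists (x ^ y); first exact: lJ.
  by exists y^-1 => //; rewrite /commg conjgK invgM invgK.
move=> /inc[x lx [y _ ->]].
exists ([~ x, y ^+ 2] :: nseq n [~ x ^ y, y]); split.
- move=> z; rewrite inE => /orP[/eqP->|/nseqP[-> _]]; apply/inc.
    by exists x => //; exists (y ^+ 2).
  by exists (x ^ y); [apply: lJ|exists y].
- by rewrite /= size_nseq.
rewrite commg_expS; last exact/nP/lcR.
by rewrite big_cons; congr (_ * _); rewrite big_nseq iter_mulg_1.
Qed.

(** * Universal properties of quotients, free products and nu *)

Section QuotientLift.
Variables (G K : groupType) (N : set G) (nN : normal N).
Variable f : UMagmaMorphism.type G K.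

(** The proof is an argument so that the term determines its morphism
structure. *)
Definition quotient_lift (_ : N `<=` [set x | f x = 1])
  (u : quotient_group nN) : K := f (repr u).

Hypothesis fN : N `<=` [set x | f x = 1].

Lemma quotient_liftE x : quotient_lift fN (coset nN x) = f x.
Proof.
have /coset_eqP/fN := cosetK (coset nN x).
by rewrite /= gmulfM gmulfV => /mulg1_eq; rewrite invgK.
Qed.

Lemma quotient_liftM : {morph quotient_lift fN : u v / u * v}.
Proof.
move=> u v; have [x <-] := coset_surj u; have [y <-] := coset_surj v.
by rewrite -cosetM !quotient_liftE gmulfM.
Qed.

Lemma quotient_lift1 : quotient_lift fN 1 = 1.
Proof. by apply: etrans (quotient_liftE 1) _; rewrite gmulf1. Qed.

HB.instance Definition _ := isUMagmaMorphism.Build (quotient_group nN) K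
  (quotient_lift fN) (quotient_lift1, quotient_liftM).

End QuotientLift.

Arguments quotient_lift : simpl never.

Section FreeProductLift.
Variables (G H K : groupType).
Variables (p : UMagmaMorphism.type G K) (q : UMagmaMorphism.type H K).

Definition letter_image (l : G + H) : K :=
  match l with inl x => p x | inr y => q y end.

Definition word_image (w : seq (G + H)) : K := \prod_(l <- w) letter_image l.

Lemma word_image_cong u v : fprod_cong u v -> word_image u = word_image v.
Proof.
rewrite /word_image; elim=> {u v} [//|u v _ -> //|u v w _ -> //|||||].
- by move=> u u' v v' _ uu' _ vv'; rewrite !big_cat uu' vv'.
- by rewrite big_seq1 big_nil /= gmulf1.
- by rewrite big_seq1 big_nil /= gmulf1.
- by move=> x y; rewrite !big_cons big_nil /= !mulg1 gmulfM.
- by move=> x y; rewrite !big_cons big_nil /= !mulg1 gmulfM.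
Qed.

Definition fprod_lift (a : free_product G H) : K := word_image (repr a).

Lemma fprod_liftE w : fprod_lift (fprod_word w) = word_image w.
Proof. by apply: word_image_cong; apply/fprod_wordP/fprod_wordK. Qed.

Lemma fprod_liftM : {morph fprod_lift : a b / a * b}.
Proof.
move=> a b; rewrite -[a]fprod_wordK -[b]fprod_wordK.
rewrite -[fprod_word _ * _]/(fprod_mul _ _) fprod_mulE !fprod_liftE.
by rewrite /word_image big_cat.
Qed.

Lemma fprod_lift1 : fprod_lift 1 = 1.
Proof. by apply: etrans (fprod_liftE [::]) _; rewrite /word_image big_nil. Qed.

HB.instance Definition _ :=
  isUMagmaMorphism.Build (free_product G H) K fprod_lift
    (fprod_lift1, fprod_liftM).

Lemma fprod_lift_inl x : fprod_lift (fprod_inl H x) = p x.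
Proof. by rewrite fprod_liftE /word_image big_seq1. Qed.

Lemma fprod_lift_inr y : fprod_lift (fprod_inr G y) = q y.
Proof. by rewrite fprod_liftE /word_image big_seq1. Qed.

End FreeProductLift.

Section NuLift.
Variables (G K : groupType) (p q : UMagmaMorphism.type G K).

Definition nu_compatible : Prop := forall g h k,
  [~ p g, q h] ^ p k = [~ p (g ^ k), q (h ^ k)] /\
  [~ p g, q h] ^ q k = [~ p (g ^ k), q (h ^ k)].

Hypothesis pq : nu_compatible.

Lemma nu_relators_lift :
  normal_closure (@nu_relators G) `<=` [set r | fprod_lift p q r = 1].
Proof.
apply: (sub_normal_closure (kernel_normal (fprod_lift p q))).
move=> r [g [h [k rE]]]; have [relp relq] := pq g h k.
by case: rE => ->; rewrite /= gmulfF gmulfJ !gmulfR /=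
  !fprod_lift_inl !fprod_lift_inr ?relp ?relq divgg.
Qed.

Definition nu_lift : UMagmaMorphism.type (nu G) K :=
  quotient_lift nu_relators_lift.

Lemma nu_lift_inl g : nu_lift (nu_inl g) = p g.
Proof. by rewrite /nu_lift /nu_inl /= quotient_liftE /= fprod_lift_inl. Qed.

Lemma nu_lift_phi g : nu_lift (nu_phi g) = q g.
Proof. by rewrite /nu_lift /nu_phi /= quotient_liftE /= fprod_lift_inr. Qed.

End NuLift.

(** * The structure of nu(G) over G x G x G *)

Section NuStructure.
Variable G : groupType.
Local Notation i := (@nu_inl G).
Local Notation j := (@nu_phi G).
Local Notation Upsilon := (@upsilon G).
Implicit Types (g h k : G) (x y t : nu G).

Lemma nu_inlM : {morph i : g h / g * h}.
Proof. by move=> g h; rewrite /nu_inl fprod_inlM cosetM. Qed.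

Lemma nu_phiM : {morph j : g h / g * h}.
Proof. by move=> g h; rewrite /nu_phi fprod_inrM cosetM. Qed.

Lemma nu_inl1 : i 1 = 1.
Proof. by apply: (mulgI (i 1)); rewrite -nu_inlM !mulg1. Qed.

Lemma nu_phi1 : j 1 = 1.
Proof. by apply: (mulgI (j 1)); rewrite -nu_phiM !mulg1. Qed.

HB.instance Definition _ :=
  isUMagmaMorphism.Build G (nu G) i (nu_inl1, nu_inlM).
HB.instance Definition _ :=
  isUMagmaMorphism.Build G (nu G) j (nu_phi1, nu_phiM).

Lemma nu_relator_trivial (r : free_product G G) : nu_relators r ->
  coset (normal_closure_normal (@nu_relators G)) r = 1.
Proof. by move=> rr; apply/coset_eq1; apply: sub_gen_smallest. Qed.

Lemma nu_conj_inl g h k : [~ i g, j h] ^ i k = [~ i (g ^ k), j (h ^ k)].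
Proof.
rewrite /nu_inl /nu_phi -!gmulfR -gmulfJ; apply: divg1_eq.
by rewrite -gmulfF; apply: nu_relator_trivial; exists g, h, k; left.
Qed.

Lemma nu_conj_phi g h k : [~ i g, j h] ^ j k = [~ i (g ^ k), j (h ^ k)].
Proof.
rewrite /nu_inl /nu_phi -!gmulfR -gmulfJ; apply: divg1_eq.
by rewrite -gmulfF; apply: nu_relator_trivial; exists g, h, k; right.
Qed.

Lemma nu_ind (P : nu G -> Prop) :
    P 1 -> (forall x g, P x -> P (x * i g)) ->
    (forall x g, P x -> P (x * j g)) ->
  forall x, P x.
Proof.
move=> P1 Pi Pj x; have [a <-] := coset_surj x; rewrite -[a]fprod_wordK.
elim/last_ind: (repr a) => [//|w l IHw].
have -> : fprod_word (rcons w l) = fprod_word w * fprod_word [:: l].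
  by rewrite -cats1; apply/esym/fprod_mulE.
by rewrite cosetM; case: l => g; [apply: Pi|apply: Pj].
Qed.

Lemma upsilon_commg g h : Upsilon [~ i g, j h].
Proof.
apply: sub_gen_smallest; exists (i g); first by exists g.
by exists (j h) => //; exists h.
Qed.

Lemma sub_upsilon (H : set (nu G)) : subgroup H ->
  (forall g h, H [~ i g, j h]) -> Upsilon `<=` H.
Proof.
move=> sH HR; apply: sub_generated => // _ [_ [g _ <-] [_ [h _ <-] ->]].
exact: HR.
Qed.

Lemma upsilon_conj_inl_phi t k : Upsilon t -> t ^ i k = t ^ j k.
Proof.
move: t; apply: (@sub_upsilon [set t | t ^ i k = t ^ j k]) => [|g h] /=.
  apply/subgroupP; split=> [|x y /= xk yk]; first by rewrite /= !conj1g.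
  by rewrite !conjMg !conjVg xk yk.
by rewrite nu_conj_inl nu_conj_phi.
Qed.

Lemma upsilon_normal : normal Upsilon.
Proof.
have sU := @upsilon_subgroup G; split=> //.
have conj_sub z : (forall g h, Upsilon ([~ i g, j h] ^ z)) ->
    forall t, Upsilon t -> Upsilon (t ^ z).
  move=> zU; apply: (@sub_upsilon [set t | Upsilon (t ^ z)]) => //.
  apply/subgroupP; split=> [|x y /= xU yU] /=.
    by rewrite conj1g; apply: (subgroup_one sU).
  by rewrite conjMg conjVg; apply: (subgroup_div sU).
move=> + y; elim/nu_ind: y => [x|y g IHy x Ux|y g IHy x Ux].
- by rewrite conjg1.
- rewrite conjgM; apply: conj_sub; last exact: IHy.
  by move=> a b; rewrite nu_conj_inl; apply: upsilon_commg.
- rewrite conjgM; apply: conj_sub; last exact: IHy.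
  by move=> a b; rewrite nu_conj_phi; apply: upsilon_commg.
Qed.

Fact nu_fold_compatible : nu_compatible (@idfun G) (@idfun G).
Proof. by move=> g h k; rewrite !conjRg. Qed.

Fact nu_proj1_compatible : nu_compatible (@idfun G) (one_fun G).
Proof. by move=> g h k; rewrite !commg1 !conj1g. Qed.

Fact nu_proj2_compatible : nu_compatible (one_fun G) (@idfun G).
Proof. by move=> g h k; rewrite !comm1g !conj1g. Qed.

Definition nu_fold := nu_lift nu_fold_compatible.
Definition nu_proj1 := nu_lift nu_proj1_compatible.
Definition nu_proj2 := nu_lift nu_proj2_compatible.

Lemma nu_fold_inl g : nu_fold (i g) = g. Proof. exact: nu_lift_inl. Qed.
Lemma nu_fold_phi g : nu_fold (j g) = g. Proof. exact: nu_lift_phi. Qed.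
Lemma nu_proj1_inl g : nu_proj1 (i g) = g. Proof. exact: nu_lift_inl. Qed.
Lemma nu_proj1_phi g : nu_proj1 (j g) = 1. Proof. exact: nu_lift_phi. Qed.
Lemma nu_proj2_inl g : nu_proj2 (i g) = 1. Proof. exact: nu_lift_inl. Qed.
Lemma nu_proj2_phi g : nu_proj2 (j g) = g. Proof. exact: nu_lift_phi. Qed.

(** The relations say so for x in either copy of G, and Upsilon is normal. *)
Lemma upsilon_conj_fold x t : Upsilon t -> t ^ x = t ^ i (nu_fold x).
Proof.
have [_ UJ] := upsilon_normal.
elim/nu_ind: x t => [t _|x g IHx t Ut|x g IHx t Ut].
- by rewrite !gmulf1 conjg1.
- by rewrite !gmulfM nu_fold_inl !conjgM IHx.
- rewrite !gmulfM nu_fold_phi !conjgM -IHx //.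
  by rewrite upsilon_conj_inl_phi //; apply: UJ.
Qed.

Lemma nu_decomposition x : exists t g h, Upsilon t /\ x = t * i g * j h.
Proof.
have [sU UJ] := upsilon_normal.
elim/nu_ind: x => [|x k [t [g [h [Ut ->]]]]|x k [t [g [h [Ut ->]]]]].
- exists 1, 1, 1; rewrite !gmulf1 !mulg1.
  by split=> //; apply: (subgroup_one sU).
- (* k is moved past h^phi at the cost of a commutator, carried to the front *)
  pose u := [~ j h, i k] ^ (i g * i k * j h)^-1.
  exists (t * u), (g * k), h; split.
    apply: (subgroup_mul sU Ut); apply: UJ; rewrite -invgR.
    by apply: (subgroup_inv sU); apply: upsilon_commg.
  by rewrite gmulfM /u /commg /conjg !gnorm.
by exists t, g, (h * k); rewrite gmulfM mulgA.
Qed.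

(** In x = t g h^phi with t in Upsilon, the two projections of x are g and h. *)
Lemma upsilon_kernel x : nu_proj1 x = 1 -> nu_proj2 x = 1 -> Upsilon x.
Proof.
have UK (f : UMagmaMorphism.type (nu G) G) : (forall g h, f [~ i g, j h] = 1) ->
  forall t, Upsilon t -> f t = 1.
  by move=> fR; apply: sub_upsilon => //; apply: (kernel_normal f).1.
have [t [g [h [Ut ->]]]] := nu_decomposition x.
rewrite !gmulfM nu_proj1_inl nu_proj1_phi nu_proj2_inl nu_proj2_phi.
rewrite (UK nu_proj1) // => [|a b]; last by rewrite gmulfR nu_proj1_phi commg1.
rewrite (UK nu_proj2) // => [|a b]; last by rewrite gmulfR nu_proj2_inl comm1g.
by rewrite !mulg1 !mul1g => -> ->; rewrite !gmulf1 !mulg1.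
Qed.

(** Both sides are crossed homomorphisms of t, since t acts on Upsilon as its
fold does; so t may be taken to be [a, b^phi].  As b and b^phi act alike on
Upsilon, [a^b, h^phi] = [a^(b^phi), h^phi].  Expanding both sides with
a^b = a [a, b] and a^(b^phi) = a [a, b^phi] and cancelling gives the claim. *)
Lemma upsilon_commg_phi t k : Upsilon t -> [~ t, j k] = [~ i (nu_fold t), j k].
Proof.
have [sU UJ] := upsilon_normal.
pose H := [set t : nu G | forall k, [~ t, j k] = [~ i (nu_fold t), j k]].
suff /[apply] : Upsilon `<=` H by apply.
have conj_fold x g h : [~ i g, j h] ^ x = [~ i g, j h] ^ i (nu_fold x).
  by apply: upsilon_conj_fold; apply: upsilon_commg.
apply: sub_upsilon => [|a b] /=.
  apply/subgroupP; split=> [h|x y Hx Hy h]; first by rewrite !gmulf1.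
  rewrite !gmulfF !commg_divl Hx Hy (upsilon_conj_fold y^-1) ?gmulfV //.
  by apply: (subgroup_div sU); apply: upsilon_commg.
move=> h; set t0 := [~ i a, j b].
have t0E : nu_fold t0 = [~ a, b] by rewrite gmulfR nu_fold_inl nu_fold_phi.
have E : [~ i (a ^ b), j h] = [~ i a ^ j b, j h].
  rewrite -[h](conjgKV b) -nu_conj_inl upsilon_conj_inl_phi.
    by rewrite conjRg -gmulfJ.
  exact: upsilon_commg.
have aE : a ^ b = a * [~ a, b] by rewrite commgEl mulVKg.
have iaE : i a ^ j b = i a * t0 by rewrite /t0 commgEl mulVKg.
move: E; rewrite aE iaE gmulfM !commg_mull -t0E -conj_fold.
by move/mulgI.
Qed.

(** Such an x lies in Upsilon, so [x, k^phi] = [1, k^phi] = 1, and k acts on x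
as k^phi does. *)
Lemma nu_joint_kernel_central x y :
  nu_proj1 x = 1 -> nu_proj2 x = 1 -> nu_fold x = 1 -> commute x y.
Proof.
move=> x1 x2 xf; have Ux := upsilon_kernel x1 x2.
have xj k : x ^ j k = x.
  by apply/conjg_fixP; rewrite upsilon_commg_phi // xf gmulf1 comm1g.
elim/nu_ind: y => [|y g xy|y g xy]; first exact: commute1.
  apply: commuteM => //; apply/commgP/conjg_fixP.
  by rewrite upsilon_conj_inl_phi.
by apply: commuteM => //; apply/commgP/conjg_fixP.
Qed.

(** Commutators with arbitrary elements lower n by one in all three images at
once, down to the joint kernel, which is central. *)
Lemma nu_upper_central n x :
    upper_central n (nu_proj1 x) -> upper_central n (nu_proj2 x) ->
    upper_central n (nu_fold x) ->
  upper_central n.+1 x.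
Proof.
elim: n x => [|n IHn] x x1 x2 xf y.
  by apply/eqP/commgP; apply: nu_joint_kernel_central.
by apply: IHn; rewrite gmulfR; [apply: x1|apply: x2|apply: xf].
Qed.

Lemma nu_finite_index n :
  finite_index setT (@upper_central G n) ->
  finite_index setT (@upper_central (nu G) n.+1).
Proof.
move=> /(finite_index_map (upper_central_subgroup G n))[r fin_r rU].
have fin1 (f : nu G -> G) : finite_set ((r \o f) @` setT).
  by apply: sub_finite_set fin_r => _ [x _ <-]; exists (f x).
pose c x := (r (nu_proj1 x), r (nu_proj2 x), r (nu_fold x)).
apply: (finite_indexP (f := c)).
  have fin2 := finite_setX (fin1 nu_proj1) (fin1 nu_proj2).
  have := finite_setX fin2 (fin1 nu_fold); apply: sub_finite_set => _ [x _ <-].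
  by split; [split|]; exists x.
move=> x y _ _ [r1 r2 rf].
by apply: nu_upper_central; rewrite gmulfF; apply: rU.
Qed.

End NuStructure.

(** * Passing to the two conclusions *)

Lemma finite_by_nilpotent_upper_central (G : groupType) :
  finite_by_nilpotent G -> exists n, finite_index setT (@upper_central G n).
Proof.
move=> [N [nN [fN [c cE]]]]; apply: (@hall_upper_central _ c N) => // x.
move/(morph_lower_central (coset nN)); rewrite cE.
exact: (coset_eq1 nN x).1.
Qed.

Lemma subgroup_type_nilpotent (G : groupType) (H : set G) (sH : subgroup H) n :
  H `<=` upper_central n -> nilpotent (subgroup_type sH).
Proof.
move=> Hn; exists n.
suff sub m : (m <= n)%N -> @lower_central (subgroup_type sH) m `<=`
    [set x | upper_central (n - m) (val x : G)].
  apply/seteqP; split=> [x /sub|x ->]; last first.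
    exact: (subgroup_one (lower_central_normal _ n).1).
  by rewrite subnn /= => /(_ (leqnn n)) x1; apply: val_inj.
elim: m => [_ x _|m IHm mn].
  by rewrite subn0; apply: Hn; apply/set_mem/(valP x).
have sU := upper_central_subgroup G (n - m.+1).
apply: sub_lower_centralS => [|x y /(IHm (ltnW mn))] /=.
  apply/subgroupP; split=> [|x y /= xU yU]; first exact: (subgroup_one sU).
  exact: (subgroup_div sU).
by rewrite -subnSK // => xU; apply: xU.
Qed.

Lemma finite_index_quotient (G : groupType) (N : set G) (nN : normal N) :
  finite_index setT N -> finite_set [set: quotient_group nN].
Proof.
move=> [s sN]; apply: sub_finite_set (finite_seq (map (coset nN) s)) => u _.
have [x <-] := coset_surj u; have [//|t ts xt] := sN x.
apply/mapP; exists t => //; apply: divg1_eq.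
by rewrite -gmulfF; apply/coset_eq1.
Qed.

Lemma subgroup_type_finite_by_nilpotent (G : groupType) (H : set G)
    (sH : subgroup H) n :
  finite_set (@lower_central G n) -> finite_by_nilpotent (subgroup_type sH).
Proof.
move=> fin; pose N := @lower_central (subgroup_type sH) n.
have nN : normal N := lower_central_normal _ n.
exists N, nN; split.
  have val_inj_in : {in val @^-1` @lower_central G n &,
      injective (val : subgroup_type sH -> G)}.
    by move=> x y _ _; apply: val_inj.
  apply: sub_finite_set (finite_preimage val_inj_in fin) => x.
  exact: (morph_lower_central val).
exists n; apply/seteqP; split=> [u|u ->]; last first.
  exact: (subgroup_one (lower_central_normal _ n).1).
move=> /(lower_central_lift (@coset_surj _ _ nN))[x Nx <-].
by apply/coset_eq1.
Qed.

Theorem theoremA (G : groupType) (hG : finite_by_nilpotent G) :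
  finite_by_nilpotent (tensor_square G) /\ nilpotent_by_finite (nu G).
Proof.
have [n /nu_finite_index fin] := finite_by_nilpotent_upper_central hG.
split.
  exact: subgroup_type_finite_by_nilpotent (baer_lower_central fin).
exists (upper_central n.+1), (upper_central_normal _ _); split.
  by apply: (@subgroup_type_nilpotent _ _ _ n.+1).
exact: finite_index_quotient.
Qed.
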